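(* Any graph $G$ with maximum node degree $\Delta$ and a $\beta$-node-separator of size $Cn^\alpha$ ($C>0$, $0\le\alpha<1$, $1/2\le\beta<1$) has a $\frac{\beta}{1-\epsilon}$-decomposition tree with expansion $O(C\Delta n^\alpha/\epsilon)$, where $0<\epsilon<1-\beta$.
   Context: $V(G)$ denotes the node set of a graph $G$. Separators: let $1/2\le\beta<1$ and let $s(n)$ be a non-decreasing function. A graph $G$ has a $\beta$-node-separator of size $s(n)$ if $|V(G)|=1$, or if $G$ can be partitioned into two subgraphs with at most $\beta|V(G)|$ nodes each and with no edges connecting the subgraphs by removing at most $s(|V(G)|)$ nodes, and the subgraphs recursively have a $\beta$-node-separator of size $s(n)$. A graph $G$ has a $\beta$-edge-separator of size $s(n)$ if $|V(G)|=1$, or if $G$ can be partitioned into two subgraphs with at most $\lceil\beta|V(G)|\rceil$ nodes each and with no edges connecting the subgraphs by removing at most $s(|V(G)|)$ edges, and the subgraphs recursively have a $\beta$-edge-separator of size $s(n)$. Decomposition tree: the process of partitioning $G$ into isolated nodes using an edge-separator repeatedly is described by a decomposition tree $\mathcal T$, a rooted tree whose node set $V(\mathcal T)$ is a set of subgraphs of $G$, such that the root is $G$, each non-leaf node $H\in V(\mathcal T)$ has exactly two children, obtained from $H$ by removing the edge-separator of $H$, and each leaf consists of a single node of $G$. $\mathcal T$ is a $\beta$-decomposition tree with expansion $x(n)$ if it can be constructed using a $\beta$-edge-separator and, for each $H\in V(\mathcal T)$, at most $x(|V(H)|)$ edges of $G$ (the external edges of $H$) connect $V(H)$ and $V(G)\setminus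 V(H)$.
   Formalization: The case α = 0 is excluded (0 < α < 1 is assumed), since the claim fails there: a k-clique plus exponentially many isolated nodes has a 1/2-node-separator of size 1, yet every decomposition tree has a subgraph with order k² external edges, while CΔ/ε is of order k. *)

(* Defs.v *)
(* MathComp / MathComp-Analysis. *)
From HB Require Import structures.
From mathcomp Require Import all_boot all_order all_algebra.
From mathcomp Require Import reals exp.

Set Implicit Arguments.
Unset Strict Implicit.
Unset Printing Implicit Defensive.

Import Order.TTheory GRing.Theory Num.Theory.

Local Open Scope ring_scope.

(* A graph is a finite type T of nodes with an adjacency relation e; its
   subgraphs are the induced ones, given by their node sets.  Nothing is lost:
   deleting nodes leaves an induced subgraph, and so does deleting the edges
   between two parts. *)
Definition simple_graph (T : finType) (e : rel T) : Prop :=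
  symmetric e /\ irreflexive e.

Definition max_degree (T : finType) (e : rel T) : nat :=
  \max_(v : T) #|[set w | e v w]|.

(* For disjoint X and Y every undirected edge is counted once. *)
Definition edges_between (T : finType) (e : rel T) (X Y : {set T}) : nat :=
  #|[set p in setX X Y | e p.1 p.2]|.

(* The removed nodes are U :\: (A :|: B).  The parts may be empty (two adjacent
   nodes have no separator otherwise), so the empty subgraph is a base case
   too. *)
Inductive has_node_separator (R : realType) (T : finType) (e : rel T)
    (beta : R) (s : nat -> R) : {set T} -> Prop :=
| NodeSepBase (U : {set T}) :
    (#|U| <= 1)%N -> has_node_separator e beta s U
| NodeSepSplit (U A B : {set T}) :
    A \subset U -> B \subset U -> [disjoint A & B] ->
    #|U :\: (A :|: B)|%:R <= s #|U| ->
    #|A|%:R <= beta * #|U|%:R -> #|B|%:R <= beta * #|U|%:R ->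
    edges_between e A B = 0%N ->
    has_node_separator e beta s A -> has_node_separator e beta s B ->
    has_node_separator e beta s U.

(* Only the leaves carry data: an internal node of a decomposition tree is the
   subgraph induced by the graph nodes at the leaves below it. *)
Inductive dtree (T : Type) : Type :=
| DLeaf of T
| DNode of dtree T & dtree T.

Fixpoint nodes_of (T : finType) (t : dtree T) : {set T} :=
  match t with
  | DLeaf v => [set v]
  | DNode l r => nodes_of l :|: nodes_of r
  end.

Fixpoint edge_separator_tree (R : realType) (T : finType) (e : rel T)
    (beta : R) (s : nat -> R) (t : dtree T) : Prop :=
  match t with
  | DLeaf _ => True
  | DNode l r =>
      [/\ [disjoint nodes_of l & nodes_of r],
          (#|nodes_of l|%:Z <= Num.ceil (beta * #|nodes_of t|%:R))
            /\ (#|nodes_of r|%:Z <= Num.ceil (beta * #|nodes_of t|%:R)),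
          (edges_between e (nodes_of l) (nodes_of r))%:R <= s #|nodes_of t|,
          edge_separator_tree e beta s l
        & edge_separator_tree e beta s r]
  end.

Definition external_edges (T : finType) (e : rel T) (H : {set T}) : nat :=
  edges_between e H (~: H).

Fixpoint has_expansion (R : realType) (T : finType) (e : rel T)
    (x : nat -> R) (t : dtree T) : Prop :=
  (external_edges e (nodes_of t))%:R <= x #|nodes_of t| /\
  match t with
  | DLeaf _ => True
  | DNode l r => has_expansion e x l /\ has_expansion e x r
  end.

(* The size of the edge-separator is unconstrained, apart from being a
   non-decreasing function of the number of nodes. *)
Definition decomposition_tree (R : realType) (T : finType) (e : rel T)
    (beta : R) (x : nat -> R) (t : dtree T) : Prop :=
  [/\ nodes_of t = [set: T],
      exists2 s : nat -> R, {homo s : m n / (m <= n)%N >-> m <= n}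
                          & edge_separator_tree e beta s t
    & has_expansion e x t].

(* Main.v *)
(* A node H of the tree is a disjoint union of two sets: X, a union of mutually
   non-adjacent sets that still have node separators, and the nodes H :\: X that
   were put in some separator on the way down.  Give a node of X the number of
   its neighbours outside X as weight, and a removed node the weight Delta, so
   that the weight of H bounds its external edges.  The recursive separators
   induce a linear order of X such that a prefix can be detached from the rest
   by removing the separators along one path, O(C |X|^alpha) nodes in all since
   the sizes along it decrease geometrically.  As for a necklace shared by two
   thieves, some window of |H|/2 consecutive nodes carries half of the weight up
   to Delta; it is detached by two cuts.  The weight E(n) allowed for n nodes
   then has to satisfy E(n)/2 + O(C Delta n^alpha) <= E(n/2), and
   E(n) = K C Delta n^alpha does because alpha < 1.  The bisection is exact up to rounding, so eps only
   enters through 1 <= 1 / eps. *)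
Require Import Defs.
From mathcomp Require Import all_boot all_order all_algebra.
From mathcomp Require Import reals exp.
From mathcomp Require Import zify ring lra.

Set Implicit Arguments.
Unset Strict Implicit.
Unset Printing Implicit Defensive.

Import Order.TTheory GRing.Theory Num.Theory.

Local Open Scope ring_scope.

(** * Colour changes along a boolean sequence *)

Fixpoint changes (b : seq bool) : nat :=
  (* The default [x] of [head] makes the last entry contribute 0. *)
  if b is x :: b' then ((x != head x b') + changes b')%N else 0%N.

Lemma changes_cat (b1 b2 : seq bool) :
  (changes b1 + changes b2 <= changes (b1 ++ b2))%N.
Proof.
elim: b1 => [|x [|y b1] IH] //=; first by rewrite eqxx leq_addl.
by rewrite -addnA leq_add2l.
Qed.

Lemma changes_nseq_cat (n : nat) (x : bool) (b : seq bool) :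
  (changes (nseq n x ++ b) <= 1 + changes b)%N.
Proof.
elim: n => [|[|n] IH] /=; [exact: leq_addl | by rewrite leq_add2r leq_b1 |].
by rewrite eqxx.
Qed.

Lemma changes_eq0 (b : seq bool) : changes b = 0%N -> constant b.
Proof.
elim: b => [|x [|y b] IH] //= /eqP; rewrite addn_eq0 eqb0 negbK.
by move=> /andP[/eqP -> /eqP/IH /= ->]; rewrite eqxx.
Qed.

(** * Cutting sets with node separators along a linear order *)

Lemma edges_between0P (T : finType) (e : rel T) (A B : {set T}) :
  reflect (forall x y, x \in A -> y \in B -> ~~ e x y)
          (edges_between e A B == 0%N).
Proof.
rewrite cards_eq0; apply: (iffP eqP) => [AB0 x y xA yB|AB0].
  by apply/negP => exy; move/setP/(_ (x, y)): AB0; rewrite !inE xA yB exy.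
apply/setP => -[x y]; rewrite !inE /=; apply/negP => /andP[/andP[xA yB]].
exact/negP/AB0.
Qed.

(** A side of a cut collects pieces from many levels of the separator recursion and need not come
    with a separator of its own. Closing under non-adjacent unions gives a class that survives
    repeated cutting. *)
Inductive separable_union (R : realType) (T : finType) (e : rel T)
    (beta : R) (s : nat -> R) : {set T} -> Prop :=
| SepUnionBase (A : {set T}) :
    has_node_separator e beta s A -> separable_union e beta s A
| SepUnionJoin (A B : {set T}) :
    [disjoint A & B] -> edges_between e A B = 0%N ->
    separable_union e beta s A -> separable_union e beta s B ->
    separable_union e beta s (A :|: B).

Definition cuts (R : realType) (T : finType) (e : rel T) (beta : R)
    (s : nat -> R) (X W D : {set T}) : Prop :=
  [/\ D \subset X,
      separable_union e beta s ((X :&: W) :\: D),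
      separable_union e beta s ((X :\: W) :\: D)
    & edges_between e ((X :&: W) :\: D) ((X :\: W) :\: D) = 0%N].

(** The order [r] is fixed before [W]. A window of consecutive nodes has at most two changes, so it
    costs at most [2 * L #|X|] whatever its length. *)
Definition cheaply_cut (R : realType) (T : finType) (e : rel T)
    (beta : R) (s L : nat -> R) (X : {set T}) : Prop :=
  exists2 r : seq T, uniq r /\ r =i X & forall W : {set T},
  exists2 D : {set T}, cuts e beta s X W D &
    #|D|%:R <= (changes [seq v \in W | v <- r])%:R * L #|X|.

Lemma monochrome_cut (T : finType) (X W : {set T}) (r : seq T) :
  r =i X -> changes [seq v \in W | v <- r] = 0%N ->
  X :&: W = X /\ X :\: W = set0 \/ X :&: W = set0 /\ X :\: W = X.
Proof.
move=> rX /changes_eq0 rW.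
have [b Wb] : exists b, forall v, v \in X -> (v \in W) = b.
  case: r rX rW => [|u r] rX rW; first by exists true => v; rewrite -rX.
  exists (u \in W) => v; rewrite -rX inE => /predU1P[->//|vr].
  by move/allP/(_ _ (map_f _ vr))/eqP: rW.
by case: b Wb => Wb; [left|right]; split; apply/setP => v; rewrite !inE;
  case: (boolP (v \in X)) => vX; rewrite ?andbF // (Wb _ vX).
Qed.

Lemma cuts_monochrome (R : realType) (T : finType) (e : rel T) (beta : R)
    (s : nat -> R) (X W : {set T}) (r : seq T) :
  separable_union e beta s X -> r =i X ->
  changes [seq v \in W | v <- r] = 0%N -> cuts e beta s X W set0.
Proof.
move=> sX rX r0; have s0 : separable_union e beta s set0.
  by apply/SepUnionBase/NodeSepBase; rewrite cards0.
rewrite /cuts !setD0 sub0set.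
have [[-> ->]|[-> ->]] := monochrome_cut rX r0; split=> //;
  by apply/eqP/edges_between0P => x y; rewrite inE.
Qed.

Lemma cutsU (R : realType) (T : finType) (e : rel T) (beta : R)
    (s : nat -> R) (A B W DA DB : {set T}) :
  symmetric e -> [disjoint A & B] -> edges_between e A B = 0%N ->
  cuts e beta s A W DA -> cuts e beta s B W DB ->
  cuts e beta s (A :|: B) W (DA :|: DB).
Proof.
move=> esym dAB /eqP/edges_between0P AB0 [sDA A1 A2 /eqP/edges_between0P A0].
move=> [sDB B1 B2 /eqP/edges_between0P B0].
have sub (X Z D : {set T}) : (X :&: Z) :\: D \subset X.
  exact: subset_trans (subsetDl _ _) (subsetIl _ _).
have sub' (X Z D : {set T}) : (X :\: Z) :\: D \subset X.
  exact: subset_trans (subsetDl _ _) (subsetDl _ _).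
have UE (Z : {set T}) : ((A :|: B) :&: Z) :\: (DA :|: DB) =
    ((A :&: Z) :\: DA) :|: ((B :&: Z) :\: DB).
  apply/setP => v; rewrite !inE.
  have [vA|vA] := boolP (v \in A).
    have vB := disjointFr dAB vA.
    by rewrite vB (contraFF (subsetP sDB v)) ?vB ?orbF ?andbF ?orbF.
  by rewrite (contraNF (subsetP sDA v)) //= andbF.
have UE' : ((A :|: B) :\: W) :\: (DA :|: DB) =
    ((A :\: W) :\: DA) :|: ((B :\: W) :\: DB).
  by rewrite ![_ :\: W]setDE UE.
rewrite /cuts UE UE'; split.
- exact: setUSS.
- apply: SepUnionJoin => //; first exact: disjointW (sub _ _ _) (sub _ _ _) dAB.
  apply/eqP/edges_between0P => x y /(subsetP (sub _ _ _)) xA.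
  by move=> /(subsetP (sub _ _ _)); apply: AB0.
- apply: SepUnionJoin => //.
    exact: disjointW (sub' _ _ _) (sub' _ _ _) dAB.
  apply/eqP/edges_between0P => x y /(subsetP (sub' _ _ _)) xA.
  by move=> /(subsetP (sub' _ _ _)); apply: AB0.
apply/eqP/edges_between0P => x y; rewrite !in_setU.
move=> /orP[x1|x1] /orP[y2|y2]; [exact: A0| | |exact: B0].
  exact: AB0 (subsetP (sub _ _ _) _ x1) (subsetP (sub' _ _ _) _ y2).
rewrite esym.
exact: AB0 (subsetP (sub' _ _ _) _ y2) (subsetP (sub _ _ _) _ x1).
Qed.

Lemma cuts_subset (R : realType) (T : finType) (e : rel T) (beta : R)
    (s : nat -> R) (A U W D : {set T}) :
  A \subset U -> cuts e beta s A W D -> cuts e beta s U W (U :\: A :|: D).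
Proof.
move=> sAU [sDA A1 A2 A0].
have UE (Z : {set T}) : (U :&: Z) :\: (U :\: A :|: D) = (A :&: Z) :\: D.
  apply/setP => v; rewrite !inE; have [vA|vA] := boolP (v \in A).
    by rewrite (subsetP sAU _ vA).
  by rewrite /= andbF; case: (v \in U); rewrite ?andbF.
have UE' : (U :\: W) :\: (U :\: A :|: D) = (A :\: W) :\: D.
  by rewrite ![_ :\: W]setDE UE.
by rewrite /cuts UE UE' subUset subsetDl (subset_trans sDA).
Qed.

(** The order lists [A], then the separator, then [B], recursively. If [W] is constant along it,
    nothing is removed; otherwise some change pays for the separator, and the changes inside [A] and
    [B] pay for the recursive cuts. Each part has at most [beta * #|U|] nodes, so the last
    hypothesis on [L] telescopes the costs along a path of the recursion. *)
Lemma has_node_separator_cheaply_cut (R : realType) (T : finType) (e : rel T)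
    (beta : R) (s L : nat -> R) (U : {set T}) :
  symmetric e -> (forall n, 0 <= s n) -> (forall n, 0 <= L n) ->
  {homo L : m n / (m <= n)%N >-> m <= n} ->
  (forall m n, m%:R <= beta * n%:R -> s n + L m <= L n) ->
  has_node_separator e beta s U -> cheaply_cut e beta s L U.
Proof.
move=> esym s_ge0 L_ge0 L_mono sL.
have card0_le k x : 0 <= x -> #|(set0 : {set T})|%:R <= k%:R * x :> R.
  by move=> x_ge0; rewrite cards0 mulr_ge0.
elim=> {U}[U U_le1|U A B sAU sBU dAB hS hA hB AB0 nA IHA nB IHB].
  exists (enum U).
    by split; [exact: enum_uniq | move=> v; rewrite mem_enum].
  move=> W; exists set0; last exact: card0_le.
  apply: (cuts_monochrome (r := enum U)).
  - exact/SepUnionBase/NodeSepBase.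
  - by move=> v; rewrite mem_enum.
  by move: U_le1; rewrite cardE; case: (enum U) => [|a [|]] //=; rewrite eqxx.
have [rA [uA rAE] cutA] := IHA; have [rB [uB rBE] cutB] := IHB.
set S := U :\: (A :|: B) in hS *.
pose r := rA ++ enum S ++ rB.
have rU : r =i U.
  move=> v; rewrite !mem_cat mem_enum rAE rBE !inE.
  have := subsetP sAU v; have := subsetP sBU v.
  case: (v \in A) => [_ ->|] //.
  by case: (v \in B) => [-> //|_ _]; rewrite orbF.
exists r.
  split=> //; rewrite !cat_uniq uA uB enum_uniq /= !andbT; apply/andP; split.
    apply/hasPn => v; rewrite mem_cat mem_enum rBE rAE !inE.
    by case: (boolP (v \in A)) => //= vA; rewrite (disjointFr dAB vA).
  apply/hasPn => v; rewrite mem_enum rBE !inE => ->.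
  by rewrite orbT.
move=> W; have [r0|r_gt0] := posnP (changes [seq v \in W | v <- r]).
  (* Without a change the allowed cost is 0, so not even [S] may be removed. *)
  exists set0; last exact: card0_le.
  apply: cuts_monochrome rU r0.
  exact/SepUnionBase/(NodeSepSplit (A := A) (B := B)).
have [DA cDA hDA] := cutA W; have [DB cDB hDB] := cutB W.
exists (S :|: (DA :|: DB)).
  by apply: cuts_subset; [rewrite subUset sAU | exact: cutsU].
have : (#|S :|: (DA :|: DB)| <= #|S| + (#|DA| + #|DB|))%N.
  by apply: leq_trans (leq_card_setU _ _) _; rewrite leq_add2l leq_card_setU.
rewrite -(ler_nat R) !natrD => /le_trans; apply.
set k := changes _ in r_gt0 *.
set a := changes _ in hDA; set b := changes _ in hDB.
have abk : (a + b <= k)%N.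
  rewrite /k /r !map_cat; apply: leq_trans (changes_cat _ _); rewrite leq_add2l.
  by apply: leq_trans (changes_cat _ _); exact: leq_addl.
(* Charging both parts at the larger size bounds the cost by [s + (a + b) * L m], which is at most
   [k * (s + L m)] because [a + b <= k] and [1 <= k]. *)
pose m := maxn #|A| #|B|.
have Lm : s #|U| + L m <= L #|U|.
  by apply: sL; rewrite /m; case: (leqP #|A| #|B|) => _.
have LA : L #|A| <= L m by apply/L_mono/leq_maxl.
have LB : L #|B| <= L m by apply/L_mono/leq_maxr.
apply: (@le_trans _ _ (s #|U| + (a%:R * L m + b%:R * L m))).
  apply: lerD => //; apply: lerD.
    by apply: le_trans hDA _; apply: ler_wpM2l.
  by apply: le_trans hDB _; apply: ler_wpM2l.
rewrite -mulrDl -natrD; apply: (@le_trans _ _ (k%:R * (s #|U| + L m))).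
  rewrite mulrDr; apply: lerD; first by rewrite ler_peMl // ler1n.
  by apply: ler_wpM2r; rewrite ?ler_nat.
exact: ler_wpM2l.
Qed.

Lemma separable_union_cheaply_cut (R : realType) (T : finType) (e : rel T)
    (beta : R) (s L : nat -> R) (X : {set T}) :
  symmetric e -> (forall n, 0 <= s n) -> (forall n, 0 <= L n) ->
  {homo L : m n / (m <= n)%N >-> m <= n} ->
  (forall m n, m%:R <= beta * n%:R -> s n + L m <= L n) ->
  separable_union e beta s X -> cheaply_cut e beta s L X.
Proof.
move=> esym s_ge0 L_ge0 L_mono sL.
elim=> {X}[A nA|A B dAB AB0 _ [rA [uA rAE] cutA] _ [rB [uB rBE] cutB]].
  exact: has_node_separator_cheaply_cut.
exists (rA ++ rB).
  split; last by move=> v; rewrite mem_cat rAE rBE inE.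
  rewrite cat_uniq uA uB andbT; apply/hasPn => v; rewrite rBE rAE => vB.
  by rewrite (disjointFl dAB vB).
move=> W; have [DA cDA hDA] := cutA W; have [DB cDB hDB] := cutB W.
exists (DA :|: DB); first exact: cutsU.
have : (#|DA :|: DB| <= #|DA| + #|DB|)%N by rewrite leq_card_setU.
rewrite -(ler_nat R) natrD => /le_trans; apply.
apply: (@le_trans _ _ ((changes [seq v \in W | v <- rA])%:R * L #|A :|: B| +
    (changes [seq v \in W | v <- rB])%:R * L #|A :|: B|)).
  apply: lerD; [apply: le_trans hDA _ | apply: le_trans hDB _];
    apply: ler_wpM2l => //; apply: L_mono;
    by rewrite subset_leq_card ?subsetUl ?subsetUr.
by rewrite -mulrDl -natrD map_cat ler_wpM2r // ler_nat changes_cat.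
Qed.

(** * Windows carrying half of the weight *)

(** A discrete intermediate value argument: sliding the window by one place changes its weight by at
    most [d], and the first and last windows together weigh the total up to [d]. So they lie on
    opposite sides of half the total, up to [d], and some window in between is balanced. *)
Lemma balanced_window (a : nat -> nat) (d n : nat) :
  (forall k, (a k <= d)%N) ->
  exists i, let f := (\sum_(i <= k < i + n./2) a k)%N in
  [/\ (i + n./2 <= n)%N, (f.*2 <= \sum_(0 <= k < n) a k)%N
    & (\sum_(0 <= k < n) a k <= f.*2 + d.*2)%N].
Proof.
move=> a_le; set h := n./2; set S := (\sum_(0 <= k < n) a k)%N.
pose f i := (\sum_(i <= k < i + h) a k)%N.
have hn : (h <= n)%N by rewrite /h; lia.
have f_step i : (f i + a (i + h) = a i + f i.+1)%N.
  by rewrite /f addSn -big_nat_recr ?leq_addr //= big_ltn // ltnS leq_addr.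
(* For odd [n] both end windows miss the middle entry [a h], whence the slack [d]. *)
have f_ends : (f 0%N + f (n - h)%N <= S <= f 0%N + f (n - h)%N + d)%N.
  have -> : S = (f 0%N + \sum_(h <= k < n) a k)%N.
    by rewrite /S /f add0n (big_cat_nat (n := h)).
  rewrite /f [in (n - h + h)%N]subnK //.
  have [nh|nh] : n = (h + h)%N \/ n = (h + h).+1 by rewrite /h; lia.
    have -> : (n - h = h)%N by lia.
    by rewrite leqnn leq_addr.
  have -> : (n - h = h.+1)%N by lia.
  rewrite (@big_ltn _ _ _ h n) /=; last by lia.
  have := a_le h; lia.
have [f0|f0] := leqP (f 0%N).*2 S.
  (* The least such [i] works: either it is 0, or its predecessor has [f < S/2 - d] and one step
     adds at most [d]. *)
  have ex_i : exists i, (S <= (f i).*2 + d.*2)%N by exists (n - h)%N; lia.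
  case: (ex_minnP ex_i) => i Si i_min; exists i; rewrite -/(f i).
  have i_le : (i <= n - h)%N by apply: i_min; lia.
  split=> //; first by lia.
  case: i {i_le} Si i_min => [|i] // Si i_min.
  have := contra (i_min i); rewrite -!ltnNge => /(_ (leqnn _)).
  have := f_step i; have := a_le (i + h)%N; lia.
(* Here the predecessor of the least [i] has [f > S/2], and one step loses at most [d]. *)
have ex_i : exists i, ((f i).*2 <= S)%N by exists (n - h)%N; lia.
case: (ex_minnP ex_i) => i Si i_min; exists i; rewrite -/(f i).
have i_le : (i <= n - h)%N by apply: i_min; lia.
split=> //; first by lia.
case: i {i_le} Si i_min => [|i] Si i_min; first by lia.
have := contra (i_min i); rewrite -!ltnNge => /(_ (leqnn _)).
have := f_step i; have := a_le i; lia.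
Qed.

Lemma balanced_window_set (T : finType) (H : {set T}) (r : seq T)
    (w : T -> nat) (d : nat) :
  uniq r -> r =i H -> (forall v, (w v <= d)%N) ->
  exists W : {set T}, [/\ W \subset H, #|W| = #|H|./2,
    (changes [seq v \in W | v <- r] <= 2)%N,
    ((\sum_(v in W) w v).*2 <= \sum_(v in H) w v)%N
  & (\sum_(v in H) w v <= (\sum_(v in W) w v).*2 + d.*2)%N].
Proof.
move=> ur rH w_le; pose a k := nth 0%N (map w r) k.
have a_le k : (a k <= d)%N.
  rewrite /a; have [kr|kr] := ltnP k (size (map w r)); last first.
    by rewrite nth_default.
  by have /mapP[v _ ->] := mem_nth 0%N kr.
have cardH : #|H| = size r by rewrite -(eq_card rH); apply/card_uniqP.
have [i /=] := balanced_window (size r) a_le; set h := (size r)./2.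
move=> [ih f1 f2].
pose r2 := take h (drop i r).
have r_eq : r = take i r ++ r2 ++ drop h (drop i r).
  by rewrite /r2 cat_take_drop cat_take_drop.
have size_r2 : size r2 = h by rewrite size_takel // size_drop; lia.
have [u2 n1 n3] : [/\ uniq r2, ~~ has (mem r2) (take i r)
                    & ~~ has (mem r2) (drop h (drop i r))].
  move: ur; rewrite {1}r_eq !cat_uniq has_cat negb_or.
  move=> /and3P[_ /andP[n1 _] /and3P[-> n3 _]]; split=> //.
  by apply: contra n1 => /hasP[v v1 v2]; apply/hasP; exists v.
have sum_r : (\sum_(v in H) w v = \sum_(0 <= k < size r) a k)%N.
  transitivity (\sum_(v <- r) w v)%N.
    by rewrite big_uniq //; apply: eq_bigl => v; rewrite rH.
  by rewrite -(big_map w xpredT id) (big_nth 0%N) size_map.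
have sum_r2 : (\sum_(v in [set v in r2]) w v = \sum_(i <= k < i + h) a k)%N.
  transitivity (\sum_(v <- r2) w v)%N.
    by rewrite big_uniq //; apply: eq_bigl => v; rewrite inE.
  rewrite -(big_map w xpredT id) (big_nth 0%N) size_map size_r2.
  rewrite -{1}[i]add0n big_addn [(i + h)%N]addnC addnK.
  apply: eq_big_nat => k kh.
  by rewrite /a /r2 map_take map_drop nth_take ?nth_drop // addnC.
(* Along [r] membership in the window reads false, then true, then false, since [uniq r] keeps the
   nodes of [r2] out of both outer parts. Hence there are at most two changes. *)
have const (b : bool) (t : seq T) : {in t, forall v, (v \in r2) = b} ->
    [seq v \in [set v in r2] | v <- t] = nseq (size t) b.
  elim: t => //= v t IH tb; rewrite inE tb ?mem_head // IH // => u ut.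
  by apply: tb; rewrite inE ut orbT.
exists [set v in r2]; rewrite sum_r sum_r2; split=> //.
- by apply/subsetP => v; rewrite inE -rH => /mem_take/mem_drop.
- by rewrite cardH cardsE -[RHS]size_r2; apply/card_uniqP.
rewrite r_eq !map_cat (const false) => [|v v1]; last first.
  by apply: contraNF n1 => v2; apply/hasP; exists v.
rewrite (const true r2) // (const false) => [|v v1]; last first.
  by apply: contraNF n3 => v2; apply/hasP; exists v.
apply: leq_trans (changes_nseq_cat _ _ _) _; rewrite ltnS.
apply: leq_trans (changes_nseq_cat _ _ _) _; rewrite ltnS.
rewrite leqn0; set m := size _; elim: m => [|[|m] IH] //.
Qed.

(** * Boundary weights and how a cut increases them *)

Lemma edges_betweenE (T : finType) (e : rel T) (A B : {set T}) :
  edges_between e A B = (\sum_(v in A) #|[set u in B | e v u]|)%N.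
Proof.
rewrite /edges_between -sum1_card (eq_bigl (fun p : T * T =>
  (p.1 \in A) && (p.2 \in [set u in B | e p.1 u]))); last first.
  by move=> p; rewrite !inE andbA.
rewrite -(pair_big_dep (mem A) (fun v u => u \in [set u in B | e v u])
  (fun _ _ => 1%N)) /=.
by apply: eq_bigr => v _; rewrite sum1_card.
Qed.

Lemma edges_between_le (T : finType) (e : rel T) (A B : {set T}) :
  (edges_between e A B <= #|T| * #|T|)%N.
Proof. by rewrite -card_prod max_card. Qed.

Lemma degree_le (T : finType) (e : rel T) (A : {set T}) (v : T) :
  (#|[set u in A | e v u]| <= max_degree e)%N.
Proof.
apply: leq_trans (leq_bigmax v); apply: subset_leq_card.
by apply/subsetP => u; rewrite !inE => /andP[].
Qed.

(** Neighbours outside [X] count even when they lie in the same tree node: they may end up on the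
    other side of a later bisection, and then cause no further increase. *)
Definition boundary_weight (T : finType) (e : rel T) (X : {set T}) (v : T) :
    nat :=
  if v \in X then #|[set u in ~: X | e v u]| else max_degree e.

Lemma boundary_weight_le (T : finType) (e : rel T) (X : {set T}) (v : T) :
  (boundary_weight e X v <= max_degree e)%N.
Proof. by rewrite /boundary_weight; case: ifP => // _; apply: degree_le. Qed.

Lemma external_edges_le (T : finType) (e : rel T) (H X : {set T}) :
  X \subset H -> (external_edges e H <= \sum_(v in H) boundary_weight e X v)%N.
Proof.
move=> sXH; rewrite /external_edges edges_betweenE; apply: leq_sum => v _.
rewrite /boundary_weight; case: ifP => _; last exact: degree_le.
apply/subset_leq_card/subsetP => u; rewrite !inE => /andP[uH ->].
by rewrite (contra (subsetP sXH u) uH).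
Qed.

(** The two sides of the cut are not adjacent, so a node that stays gains only its neighbours in
    [D]; summed up, these are at most [#|D| * max_degree e]. Raising the nodes of [D] to full weight
    costs at most as much again. *)
Lemma boundary_weight_cuts (R : realType) (T : finType) (e : rel T) (beta : R)
    (s : nat -> R) (H X W D : {set T}) :
  symmetric e -> cuts e beta s X W D ->
  (\sum_(v in H :&: W) boundary_weight e ((X :&: W) :\: D) v <=
   \sum_(v in H :&: W) boundary_weight e X v + (#|D| * max_degree e).*2)%N.
Proof.
move=> esym [_ _ _ /eqP/edges_between0P XW0].
pose g v := ((v \in D) * max_degree e + #|[set u in D | e v u]|)%N.
have w_le v : v \in H :&: W ->
    (boundary_weight e ((X :&: W) :\: D) v <= boundary_weight e X v + g v)%N.
  rewrite inE => /andP[_ vW]; rewrite /boundary_weight /g.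
  case: ifP => [vX'|]; last first.
    rewrite !inE vW andbT; case: (v \in D) => /= [_|->]; last exact: leq_addr.
    by rewrite mul1n addnCA leq_addr.
  move: (vX'); rewrite !inE vW andbT => /andP[/negPf-> ->]; rewrite mul0n add0n.
  apply: leq_trans (leq_card_setU _ _); apply/subset_leq_card/subsetP => u.
  rewrite !inE => /andP[uX' evu]; rewrite evu !andbT.
  move: uX'; rewrite !negb_and !negbK; case: (boolP (u \in D)) => uD.
    by rewrite orbT.
  case: (boolP (u \in X)) => //= uX uW.
  have := XW0 v u vX'; rewrite evu /= !inE uD uX uW; exact.
apply: (@leq_trans (\sum_(v in H :&: W) (boundary_weight e X v + g v))).
  exact: leq_sum.
rewrite big_split leq_add2l.
apply: (@leq_trans (\sum_v g v)%N).
  rewrite [X in (_ <= X)%N](bigID (mem (H :&: W))) /=; exact: leq_addr.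
rewrite /g big_split -addnn; apply: leq_add.
  by rewrite -big_distrl /= -sum1_card [X in (_ <= X * _)%N]big_mkcond.
(* The edges into [D] are now counted from their ends in [D]. *)
under eq_bigr => v _ do rewrite -sum1_card big_mkcond.
rewrite exchange_big /= -sum_nat_const [X in (_ <= X)%N]big_mkcond.
apply: leq_sum => u _; rewrite -big_mkcond sum1dep_card.
case: ifP => uD; last first.
  by rewrite leqn0 cards_eq0; apply/eqP/setP => v; rewrite !inE uD.
apply: leq_trans (degree_le e setT u); apply/subset_leq_card/subsetP => v.
by rewrite !inE uD esym.
Qed.

(** * Recursive bisection *)

Lemma cutsC (R : realType) (T : finType) (e : rel T) (beta : R)
    (s : nat -> R) (X W D : {set T}) :
  symmetric e -> cuts e beta s X W D -> cuts e beta s X (~: W) D.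
Proof.
move=> esym [sD u1 u2 /eqP/edges_between0P u0].
have E : X :\: ~: W = X :&: W by rewrite setDE setCK.
rewrite /cuts E -setDE.
by split=> //; apply/eqP/edges_between0P => x y ? ?; rewrite esym u0.
Qed.

(** The ceiling absorbs the extra half node on the larger side of an odd bisection. *)
Lemma le_ceil_half (R : realType) (b : R) (m n : nat) :
  1 / 2 <= b -> (m.*2 <= n.+1)%N -> m%:Z <= Num.ceil (b * n%:R).
Proof.
move=> hb mn; rewrite -ltzD1 -(ltr_int R) intrD.
have := ceil_ge (b * n%:R).
have : 1 / 2 * n%:R <= b * n%:R by apply: ler_wpM2r.
have : m%:R * 2 <= n%:R + 1 :> R.
  by rewrite -natrM muln2 natr1 ler_nat.
rewrite -[m%:~R]/(m%:R : R); lra.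
Qed.

(** The recursive inequality for [F] is available only from [n0] on; below it a trivial bound [M] on
    the number of edges takes over. *)
Definition capped_expansion (R : realType) (n0 : nat) (M : R)
    (F : nat -> R) (n : nat) : R := if (n0 <= n)%N then F n else M.

(** The invariant is that [H] has weight at most [F #|H|] once [n0 <= #|H|]. A child gets half of
    the weight plus [max_degree e] from the balanced window, and [2 * #|D| * max_degree e] from the
    cut, where [#|D| <= 2 * L #|H|]; this gives the factor [1 + 4 * L n]. A child with at least [n0]
    nodes has a parent with at least [n0] nodes, so the invariant passes down. *)
Lemma bisection_tree (R : realType) (T : finType) (e : rel T)
    (beta gamma : R) (s L F : nat -> R) (n0 : nat) :
  symmetric e -> (forall n, 0 <= s n) -> (forall n, 0 <= L n) ->
  {homo L : m n / (m <= n)%N >-> m <= n} ->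
  (forall m n, m%:R <= beta * n%:R -> s n + L m <= L n) ->
  1 / 2 <= gamma ->
  (forall m n, (n0 <= m)%N -> (m <= n)%N -> (n <= m.*2.+1)%N ->
     F n / 2 + (max_degree e)%:R * (1 + 4 * L n) <= F m) ->
  forall H X : {set T}, (0 < #|H|)%N -> X \subset H ->
  separable_union e beta s X ->
  ((n0 <= #|H|)%N ->
     (\sum_(v in H) boundary_weight e X v)%N%:R <= F #|H|) ->
  exists t : dtree T,
  [/\ nodes_of t = H,
      edge_separator_tree e gamma (fun=> (#|T| * #|T|)%N%:R) t
    & has_expansion e (capped_expansion n0 (#|T| * #|T|)%N%:R F) t].
Proof.
move=> esym s_ge0 L_ge0 L_mono sL hgamma hF H.
have [k] := ubnP #|H|; elim: k H => // k IH H; rewrite ltnS => Hk X H_gt0 sXH.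
move=> uX wX.
set d := max_degree e in hF.
have hext : (external_edges e H)%:R <=
    capped_expansion n0 (#|T| * #|T|)%N%:R F #|H|.
  rewrite /capped_expansion; case: ifP => [/wX|_].
    by apply: le_trans; rewrite ler_nat external_edges_le.
  by rewrite ler_nat edges_between_le.
have [H1|H_gt1] := leqP #|H| 1.
  have /cards1P[v Hv] : #|H| == 1%N by rewrite eqn_leq H1.
  by exists (DLeaf v); rewrite /= -Hv.
have [r [ur rX] cut] :=
  separable_union_cheaply_cut esym s_ge0 L_ge0 L_mono sL uX.
(* The removed nodes share in the balancing but cost nothing to cut: the prefix [r] sees no more
   changes than [r']. *)
pose r' := r ++ enum (H :\: X).
have rH : r' =i H.
  move=> v; rewrite mem_cat mem_enum rX inE.
  by case: (boolP (v \in X)) => //= /(subsetP sXH).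
have ur' : uniq r'.
  rewrite cat_uniq ur enum_uniq andbT; apply/hasPn => v.
  by rewrite mem_enum rX inE => /andP[].
have [W [sWH cW chW w1 w2]] :=
  balanced_window_set ur' rH (boundary_weight_le e X).
have [D cutD hD] := cut W.
have {}hD : #|D|%:R <= 2 * L #|H|.
  apply: le_trans hD _; apply: (@le_trans _ _ (2 * L #|X|)).
    apply: ler_wpM2r => //; rewrite ler_nat; apply: leq_trans chW.
    by rewrite map_cat; apply: leq_trans (changes_cat _ _); exact: leq_addr.
  by rewrite ler_pM2l // L_mono // subset_leq_card.
have child (Z : {set T}) : cuts e beta s X Z D ->
    (#|H| <= #|H :&: Z|.*2.+1)%N -> (#|H :&: Z|.*2 <= #|H|.+1)%N ->
    ((\sum_(v in H :&: Z) boundary_weight e X v).*2 <=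
      \sum_(v in H) boundary_weight e X v + d.*2)%N ->
    exists t, [/\ nodes_of t = H :&: Z,
      edge_separator_tree e gamma (fun=> (#|T| * #|T|)%N%:R) t
    & has_expansion e (capped_expansion n0 (#|T| * #|T|)%N%:R F) t].
  move=> cutZ Z1 Z2 wZ; apply: (IH _ _ ((X :&: Z) :\: D)); try lia.
  - exact: subset_trans (subsetDl _ _) (setSI _ sXH).
  - by case: cutZ.
  move=> n0Z; have Z_le : (#|H :&: Z| <= #|H|)%N.
    exact/subset_leq_card/subsetIl.
  apply: le_trans (hF _ _ n0Z Z_le Z1).
  have := wX (leq_trans n0Z Z_le).
  move: wZ; rewrite -(ler_nat R) -!muln2 natrD !natrM.
  have := boundary_weight_cuts H esym cutZ.
  rewrite -(ler_nat R) -muln2 natrD !natrM.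
  have : d%:R * #|D|%:R <= d%:R * (2 * L #|H|) by apply: ler_wpM2l.
  rewrite -/d; lra.
have HWE : H :&: W = W by apply/setIidPr.
have cHW : (#|H :&: W| + #|H :&: ~: W| = #|H|)%N by rewrite -setDE cardsID.
have sHW : (\sum_(v in H :&: W) boundary_weight e X v +
    \sum_(v in H :&: ~: W) boundary_weight e X v =
    \sum_(v in H) boundary_weight e X v)%N.
  by rewrite -setDE -big_setID.
rewrite -HWE in cW w1 w2.
have [||| l [lE l1 l2]] := child W cutD; try lia.
have [||| t [tE t1 t2]] := child (~: W) (cutsC esym cutD); try lia.
exists (DNode l t); rewrite /= lE tE -setDE setID; split=> //.
split=> //.
- rewrite -setI_eq0; apply/eqP/setP => v; rewrite !inE.
  by case: (v \in W); rewrite ?andbF.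
- by rewrite setDE; split; apply: le_ceil_half => //; lia.
- by rewrite ler_nat edges_between_le.
Qed.

(** * Powers and the choice of constants *)

Lemma powR_lt1 (R : realType) (x a : R) :
  0 <= x < 1 -> 0 < a -> x `^ a < 1.
Proof.
move=> /andP[x_ge0 x_lt1] a_gt0; have <- : 1 `^ a = 1 :> R by rewrite powR1.
by apply: gt0_ltr_powR => //; rewrite nnegrE.
Qed.

(** For [a < 1] the power of [1 / 2] exceeds [1 / 2], and so does that of a slightly smaller base.
    The room below [1 / 2] is for the smaller side of an odd bisection, which has only [(n - 1) / 2]
    nodes. *)
Lemma powR_half_gap (R : realType) (a : R) : 0 < a < 1 ->
  exists2 r : R, 0 < r < 1 / 2 & 1 / 2 < r `^ a.
Proof.
(* [q] is the threshold where the power equals [1 / 2]; the witness is the midpoint of [q] and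
   [1 / 2]. *)
move=> /andP[a_gt0 a_lt1]; pose q : R := (1 / 2) `^ a^-1.
have half_gt0 : 0 < 1 / 2 :> R by rewrite divr_gt0.
have q_gt0 : 0 < q by rewrite powR_gt0.
have qa : q `^ a = 1 / 2 by rewrite -powRrM mulVf ?gt_eqF // powRr1 // ltW.
have q_lt : q < 1 / 2.
  have -> : q = 1 / 2 * (1 / 2) `^ (a^-1 - 1).
    rewrite -[X in X * _]powRr1 ?ltW // -powRD ?(gt_eqF half_gt0) ?implybT //.
    by rewrite addrC subrK.
  have : (1 / 2 : R) `^ (a^-1 - 1) < 1.
    by apply: powR_lt1; [lra | rewrite subr_gt0 invf_gt1].
  lra.
exists ((q + 1 / 2) / 2); first lra.
by rewrite -{1}qa gt0_ltr_powR // ?nnegrE; lra.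
Qed.

Theorem lemma1 (R : realType) (alpha beta : R)
    (halpha : 0 < alpha < 1) (hbeta : 1 / 2 <= beta < 1) :
  exists2 K : R, 0 < K &
  forall C : R, 0 < C ->
  exists n0 : nat,
  forall (eps : R), 0 < eps < 1 - beta ->
  forall (T : finType) (e : rel T), simple_graph e -> (0 < #|T|)%N ->
  has_node_separator e beta (fun n : nat => C * n%:R `^ alpha) [set: T] ->
  exists (x : nat -> R) (t : dtree T),
    decomposition_tree e (beta / (1 - eps)) x t /\
    (forall n : nat, (n0 <= n)%N ->
       x n <= K * (C * (max_degree e)%:R * n%:R `^ alpha / eps)).
Proof.
have [a_gt0 a_lt1] := andP halpha; have [b_ge b_lt] := andP hbeta.
have [r /andP[r_gt0 r_lt] hr] := powR_half_gap halpha.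
(* [b] is the ratio by which separator sizes shrink per level; [delta > 1 / 2] is the factor of
   [n^alpha] that a child keeps. *)
pose b := beta `^ alpha; pose delta := r `^ alpha.
have b_lt1 : b < 1 by apply: powR_lt1 => //; lra.
have K_gt0 : 0 < (1 + 4 / (1 - b)) / (delta - 1 / 2).
  apply: divr_gt0; last by rewrite subr_gt0.
  by apply: addr_gt0 => //; apply: divr_gt0 => //; rewrite subr_gt0.
(* [K] solves [K * delta = K / 2 + 1 + 4 / (1 - b)], the recursion for [F] after the 1 in
   [1 + 4 * L n] is bounded by [C * n^alpha]. *)
set K := (1 + _) / _ in K_gt0; exists K => // C C_gt0.
(* For n >= y both C n^alpha >= 1 and (n - 1) / 2 >= r n. *)
pose y : R := C `^ (- alpha^-1) + (1 - 2 * r)^-1.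
have y1_gt0 : 0 < C `^ (- alpha^-1) by rewrite powR_gt0.
have y2_gt0 : 0 < (1 - 2 * r)^-1 by rewrite invr_gt0; lra.
exists (Num.bound y) => eps /andP[eps_gt0 eps_lt] T e [esym _] T_gt0 nsep.
set n0 := Num.bound y; pose p n : R := n%:R `^ alpha.
have p_ge0 n : 0 <= p n by apply: powR_ge0.
have p_mono (u v : R) : 0 <= u -> u <= v -> u `^ alpha <= v `^ alpha.
  by move=> u0 uv; apply: ge0_ler_powR; rewrite ?nnegrE //; lra.
(* [L n] is the sum of the geometric series with terms [C * n^alpha * b^i]. *)
pose L n := C / (1 - b) * p n; pose F n := K * (C * (max_degree e)%:R * p n).
have C1_gt0 : 0 < C / (1 - b) by rewrite divr_gt0 // subr_gt0.
have large n : (n0 <= n)%N -> y <= n%:R.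
  move=> n0n; apply: le_trans (_ : n0%:R <= _); last by rewrite ler_nat.
  by apply/ltW/archi_boundP; rewrite addr_ge0 // ltW.
have F_step m n : (n0 <= m)%N -> (m <= n)%N -> (n <= m.*2.+1)%N ->
    F n / 2 + (max_degree e)%:R * (1 + 4 * L n) <= F m.
  move=> n0m mn nm; have yn := large n (leq_trans n0m mn).
  have rm : r * n%:R <= m%:R.
    have : n%:R <= m%:R * 2 + 1 :> R by rewrite -natrM muln2 natr1 ler_nat.
    have : (1 - 2 * r)^-1 <= n%:R by rewrite /y in yn; lra.
    rewrite -[X in X <= _]mul1r ler_pdivrMr; lra.
  have pm : delta * p n <= p m.
    rewrite /delta /p -powRM ?(ltW r_gt0) //.
    by apply: p_mono; rewrite // mulr_ge0 // ltW.
  have Cp : 1 <= C * p n.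
    have : (C `^ (- alpha^-1)) `^ alpha <= p n.
      by apply: p_mono; rewrite /y in yn; lra.
    rewrite -powRrM mulNr mulVf ?gt_eqF // powR_inv1 ?(ltW C_gt0) //.
    by rewrite -[X in X <= _]mul1r ler_pdivrMr // mulrC.
  rewrite /F /L.
  have -> : 1 + 4 * (C / (1 - b) * p n) = 1 + 4 / (1 - b) * (C * p n).
    by field; rewrite subr_eq0 gt_eqF.
  have : K * (C * (max_degree e)%:R * (delta * p n)) <=
      K * (C * (max_degree e)%:R * p m).
    by rewrite ler_pM2l // ler_wpM2l // mulr_ge0 // ltW.
  apply: le_trans.
  have -> : K * (C * (max_degree e)%:R * (delta * p n)) =
      K * (C * (max_degree e)%:R * p n) / 2 +
      (max_degree e)%:R * ((1 + 4 / (1 - b)) * (C * p n)).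
    rewrite /K; field; rewrite subr_eq0 (gt_eqF b_lt1) subr_eq0 gt_eqF //.
    by rewrite /delta; lra.
  rewrite lerD2l; apply: ler_wpM2l => //.
  by rewrite [leRHS]mulrDl mul1r lerD2r.
have bound_F n : F n <= K * (C * (max_degree e)%:R * n%:R `^ alpha / eps).
  rewrite /F ler_pM2l // ler_peMr ?invf_ge1 //; last by lra.
  by rewrite mulr_ge0 // mulr_ge0 // ltW.
have [|||||||||t [tE t1 t2]] := @bisection_tree R T e beta (beta / (1 - eps))
    (fun n => C * p n) L F n0 esym _ _ _ _ _ F_step setT setT.
- by move=> n; rewrite mulr_ge0 // ltW.
- by move=> n; rewrite mulr_ge0 // ltW.
- by move=> m n mn; rewrite ler_pM2l // p_mono // ler_nat.
- move=> m n mn; rewrite /L.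
  have : p m <= b * p n.
    by rewrite /b /p -powRM //; [apply: p_mono | lra].
  rewrite -(ler_pM2l C1_gt0) => /(lerD (lexx (C * p n)))/le_trans; apply.
  rewrite le_eqVlt; apply/orP; left; apply/eqP; field.
  by rewrite subr_eq0 gt_eqF.
(* Dividing by [1 - eps < 1] only raises [beta], which is at least [1 / 2]. *)
- rewrite ler_pdivlMr; nra.
- by rewrite cardsT.
- exact: subxx.
- exact: SepUnionBase.
(* At the root [X] is the whole node set, so every weight is 0. *)
- move=> _; rewrite big1 => [|v _].
    apply: mulr_ge0; first exact: ltW.
    by apply: mulr_ge0 => //; apply: mulr_ge0 => //; exact: ltW.
  rewrite /boundary_weight inE setCT; apply/eqP; rewrite cards_eq0.
  by apply/eqP/setP => u; rewrite !inE.
exists (capped_expansion n0 (#|T| * #|T|)%N%:R F), t; split.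
  by split=> //; exists (fun=> (#|T| * #|T|)%N%:R).
by move=> n n0n; rewrite /capped_expansion n0n bound_F.
Qed.
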